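(* Let $d \geq 1$. Let $\mathcal{F}$ be a finite family of sets, each of size at most $d$, and let $\mathcal{H}$ be a family of minimal covers of $\mathcal{F}$, each of which has at most $d$ elements. Then $|\bigcup \mathcal{H}| \leq b(d)$. Moreover this inequality is best possible: there exist such $\mathcal{F}$ and $\mathcal{H}$ with $|\bigcup \mathcal{H}| = b(d)$.
   Context: A set $C$ is a cover of a family $\mathcal{F}$ if $C \cap E \neq \emptyset$ for every $E \in \mathcal{F}$; it is a minimal cover if no proper subset of $C$ is a cover of $\mathcal{F}$. For a finite graph $G$, a family of subsets of $V(G)$ is an edge cover of $G$ iff every edge of $G$ is included in some member; it is a minimal edge cover iff no proper subfamily is an edge cover; it has degree $d$ if every vertex lies in at most $d$ members. $b(d)$ is the maximum cardinality of a minimal edge cover of degree $d$ of a complete bipartite graph. *)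

(* Defs.v *)
From mathcomp Require Import all_boot.
From mathcomp Require Import mathcomp_extra boolp classical_sets functions cardinality.

Set Implicit Arguments.
Unset Strict Implicit.
Unset Printing Implicit Defensive.

Local Open Scope classical_set_scope.
Local Open Scope card_scope.

Definition is_cover (T : Type) (F : set (set T)) (C : set T) : Prop :=
  forall E, F E -> C `&` E !=set0.

Definition is_minimal_cover (T : Type) (F : set (set T)) (C : set T) : Prop :=
  is_cover F C /\ forall C', C' `<` C -> ~ is_cover F C'.

(* [A #<= `I_d] says that A has at most d elements. *)
Definition admissible (T : Type) (d : nat) (F H : set (set T)) : Prop :=
  [/\ finite_set F,
      forall E, F E -> E #<= `I_d
    & forall C, H C -> is_minimal_cover F C /\ C #<= `I_d].

(* A finite graph is given by its adjacency relation on a finType. Families of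
   vertex sets are sets of sets; allowing repeated members would not add any
   minimal edge cover, since a repetition can always be dropped. *)
Definition edge_cover (V : finType) (e : rel V) (M : {set {set V}}) : Prop :=
  forall x y, e x y -> exists A, [/\ A \in M, x \in A & y \in A].

Definition minimal_edge_cover (V : finType) (e : rel V) (M : {set {set V}}) :
    Prop :=
  edge_cover e M /\ forall M' : {set {set V}}, M' \proper M -> ~ edge_cover e M'.

Definition has_degree (V : finType) (d : nat) (M : {set {set V}}) : Prop :=
  forall x : V, #|[set A in M | x \in A]%SET| <= d.

(* The two parts are X and its complement, both nonempty. *)
Definition complete_bipartite (V : finType) (e : rel V) : Prop :=
  exists X : {set V},
    [/\ X != finset.set0, (~: X)%SET != finset.set0
      & forall x y, e x y = (x \in X) (+) (y \in X)].

Definition bip_cover_size (d n : nat) : Prop :=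
  exists (V : finType) (e : rel V) (M : {set {set V}}),
    [/\ complete_bipartite e, minimal_edge_cover e M, has_degree d M & #|M| = n].

(* b = b(d), the maximum of the set [bip_cover_size d]. It is a relation, so
   that asserting [is_b d b] includes the existence of the maximum. *)
Definition is_b (d b : nat) : Prop :=
  bip_cover_size d b /\ forall n, bip_cover_size d n -> n <= b.

(* Main.v *)
(* Members of the families and elements of the union play dual roles: joining
   every member of [F] to every member of [H] gives a complete bipartite graph in
   which an element [a] of the union covers the edges [(E, C)] with [a] in both
   [E] and [C]. That each [C] meets each [E] means that all edges are covered,
   and that the covers [C] are minimal means that this edge cover is minimal.
   An infinite or too large union is cut down to finitely many members of [H]
   whose union still has more than [b] elements. *)

Require Import Defs.
From mathcomp Require Import all_boot.
From mathcomp Require Import mathcomp_extra boolp classical_sets functions cardinality.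

Local Open Scope classical_set_scope.
Local Open Scope card_scope.

(** * Enumerations and cardinalities of finite sets *)

Lemma card_eq_enum {T : Type} {n : nat} {A : set T} :
  A #= `I_n -> exists2 x : 'I_n -> T, injective x & range x = A.
Proof.
rewrite (card_eqr card_II) card_eq_sym => /card_bijP[f [g fK gK]].
exists (fun i => set_val (f (to_setT i))).
  by move=> i j /val_inj /(can_inj fK) /(congr1 set_val).
apply/seteqP; split=> [_ [i _ <-]|a Aa]; first exact: set_valP.
exists (set_val (g (SigSub (mem_set Aa)))) => //.
have -> : to_setT (set_val (g (SigSub (mem_set Aa)))) = g (SigSub (mem_set Aa)).
  exact/val_inj.
by rewrite gK.
Qed.

Lemma card_eq_finset {V : finType} (S : {set V}) : [set` S] #= `I_#|S|.
Proof.
rewrite (card_eqr card_II) card_eq_sym.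
have <- : range (@enum_val V (mem S)) = [set` S].
  apply/seteqP; split=> [_ [i _ <-]|x Sx]; first exact: enum_valP.
  by exists (enum_rank_in Sx x) => //; rewrite enum_rankK_in.
rewrite card_eq_sym; apply: inj_card_eq => i j _ _; exact: enum_val_inj.
Qed.

Lemma card_preimage_finset {V : finType} {T : Type} {x : V -> T} {A : set T} {d : nat} :
  injective x -> A #<= `I_d -> #|[set i | `[< A (x i) >]]%SET| <= d.
Proof.
move=> xI Ad; rewrite -card_le_II -(card_le_eql (card_eq_finset _)).
have -> : [set` [set i | `[< A (x i) >]]%SET] = x @^-1` A.
  by apply/seteqP; split=> i /=; rewrite inE => /asboolP.
by apply: card_le_trans Ad; apply: card_ge_preimage => i j _ _ /xI.
Qed.

(** * Minimal covers *)

(** Otherwise every [E] in [F] would meet [C] in a point other than [x], and [C] without [x] would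
    still be a cover. *)
Lemma minimal_cover_critical {T : Type} {F : set (set T)} {C : set T} {x : T} :
  is_minimal_cover F C -> C x -> exists2 E, F E & C `&` E = [set x].
Proof.
move=> [Ccov Cmin] Cx; apply: contrapT => nE.
apply: (Cmin (C `\ x)).
  split; first exact: subDsetl.
  by move=> /(_ _ Cx)[_ /(_ erefl)].
move=> E FE; apply: contrapT => CE0; apply: nE; exists E => //.
have CEx y : C y -> E y -> y = x.
  by move=> Cy Ey; apply: contrapT => yx; apply: CE0; exists y.
have [y [Cy Ey]] := Ccov E FE.
apply/seteqP; split=> [z [Cz Ez]|_ ->]; first exact: CEx.
by rewrite -(CEx y Cy Ey).
Qed.

Lemma sub_minimal_cover {I : finType} {F : set (set I)} {C : {set I}} :
  is_cover F [set` C] ->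
  exists2 C' : {set I}, C' \subset C & is_minimal_cover F [set` C'].
Proof.
move=> Ccov; pose P := [pred C : {set I} | `[< is_cover F [set` C] >]].
have /minset_exists[C' /minsetP[/asboolP C'cov C'min] C'C] : P C by exact/asboolP.
exists C' => //; split=> // D [DC' C'D] Dcov; apply: C'D.
(* The competitor [D] is an arbitrary predicate; deciding it classically turns it into a finite set,
   to which the minimality of [C'] applies. *)
have DE : [set` [set i | `[< D i >]]%SET] = D.
  by apply/seteqP; split=> i /=; rewrite inE => /asboolP.
rewrite -DE (C'min [set i | `[< D i >]]%SET) //.
  by apply/asboolP; rewrite DE.
by apply/fintype.subsetP => i; rewrite inE => /asboolP /DC'.
Qed.

(** * Finiteness of $b(d)$ *)

(** Here [P] is the part of [C] already revealed by the branching, and [k] bounds the number of its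
    elements still unknown. For [P] empty and [k = d], every [C] in [H] of size at most [d] is taken
    into account. *)
Definition critical_elements {I : finType} (F H : {set {set I}}) (k : nat) (P : {set I}) :
    {set I} :=
  [set a | (a \notin P) &&
    [exists C in H, (P \subset C) && (#|C :\: P| <= k)
      && [exists E in F, E :&: C == [set a]]]]%SET.

(* Branching: if [P] misses some [E] in [F], then every [C] containing [P] also
   contains one of the at most [d] elements of [E]; if [P] meets all members of
   [F], then no element outside [P] is critical. *)
Lemma critical_bound {I : finType} {F H : {set {set I}}} {d : nat} :
    {in F, forall E : {set I}, #|E| <= d} ->
    {in F & H, forall E C : {set I}, E :&: C != finset.set0} ->
  forall (k : nat) (P : {set I}),
    #|critical_elements F H k P|
    <= iter k (fun m => d * m.+1) 0.
Proof.
move=> Fd FH k; elim: k => [|k IHk] P.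
  rewrite leqn0 cards_eq0 -finset.subset0; apply/fintype.subsetP => a.
  rewrite !inE => /andP[aP /exists_inP[C _ /andP[/andP[_ CP] /exists_inP[E _ /eqP EC]]]].
  have : a \in E :&: C by rewrite EC inE.
  rewrite inE => /andP[_ aC]; move: CP; rewrite leqn0 cards_eq0 => /eqP/setP/(_ a).
  by rewrite !inE aP aC.
have [/exists_inP[E0 E0F /eqP E0P]|/exists_inPn nP] :=
    boolP [exists E in F, E :&: P == finset.set0].
- apply: (@leq_trans #|(\bigcup_(a in E0) (a |: critical_elements F H k (a |: P)))%SET|).
    apply/subset_leq_card/fintype.subsetP => b.
    rewrite inE => /andP[bP /exists_inP[C CH /andP[/andP[PC CPk] bcrit]]].
    have /set0Pn[a] := FH _ _ E0F CH; rewrite inE => /andP[aE0 aC].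
    have aP : a \notin P.
      by apply/negP => aP; move/setP/(_ a): E0P; rewrite !inE aE0 aP.
    apply/finset.bigcupP; exists a => //; rewrite !inE.
    have [//|ba /=] := eqVneq b a; rewrite (negbTE bP) /=.
    apply/exists_inP; exists C => //; rewrite bcrit andbT.
    (* As [a] lies in [C] but not in [P], moving it into [P] lowers the budget by one. *)
    rewrite finset.subUset finset.sub1set aC PC /= -ltnS.
    apply: leq_trans CPk; apply/proper_card/properP; split.
      by rewrite finset.setDS // finset.subsetUr.
    by exists a; rewrite !inE ?aC ?aP ?eqxx.
  have bigU_le : #|(\bigcup_(a in E0) (a |: critical_elements F H k (a |: P)))%SET|
      <= \sum_(a in E0) #|a |: critical_elements F H k (a |: P)|.
    elim/big_rec2: _ => [|a m A _ Am]; first by rewrite cards0.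
    by rewrite (leq_trans (leq_card_setU _ _)) ?leq_add2l.
  apply: leq_trans bigU_le _.
  apply: (@leq_trans (\sum_(a in E0) (iter k (fun m => d * m.+1) 0).+1)).
    by apply: leq_sum => a _; rewrite cardsU1 -add1n leq_add ?leq_b1.
  by rewrite sum_nat_const leq_mul2r Fd ?orbT.
- rewrite [X in X <= _](_ : _ = 0) //; apply/eqP.
  rewrite cards_eq0 -finset.subset0; apply/fintype.subsetP => a.
  rewrite !inE => /andP[aP /exists_inP[C _ /andP[/andP[PC _] /exists_inP[E EF /eqP EC]]]].
  have /set0Pn[b] := nP _ EF; rewrite inE => /andP[bE bP].
  have : b \in E :&: C by rewrite inE bE (fintype.subsetP PC).
  by rewrite EC inE => /eqP ba; rewrite -ba bP in aP.
Qed.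

(** Removing [A] uncovers some edge, so no other member contains both of its ends; by symmetry the
    end in [X] can be named first. *)
Lemma private_edge {V : finType} {e : rel V} {X : {set V}} {M : {set {set V}}} {A : {set V}} :
    (forall x y, e x y = (x \in X) (+) (y \in X)) ->
    minimal_edge_cover e M -> A \in M ->
  exists x y, [/\ x \in X, y \notin X, x \in A, y \in A &
    forall B, B \in M -> x \in B -> y \in B -> B = A].
Proof.
move=> eX [Mcov Mmin] AM; apply: contrapT => nxy.
apply: (Mmin (M :\ A)); first exact: properD1.
suff half x y : x \in X -> y \notin X ->
    exists B, [/\ B \in M :\ A, x \in B & y \in B].
  move=> x y; rewrite eX.
  case: (boolP (x \in X)); case: (boolP (y \in X)) => // yX xX _; first exact: half.
  by have [B [BM yB xB]] := half y x yX xX; exists B.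
move=> xX yX; have /Mcov[B [BM xB yB]] : e x y by rewrite eX xX (negbTE yX).
have [BA|BA] := eqVneq B A; last by exists B; split; rewrite // !inE BA.
rewrite {}BA in BM xB yB *; apply: contrapT => nB; apply: nxy.
exists x, y; split=> // B' B'M xB' yB'; apply: contrapT => /eqP B'A.
by apply: nB; exists B'; rewrite !inE B'A.
Qed.

(** The members of [M] form the ground set, and the stars of the two parts form [F] and [H]. A
    private edge of [A] gives two stars that meet only in [A], so every [A] is critical. The bound
    equals $d + d^2 + \dots + d^d$. *)
Lemma bip_cover_size_bounded (d n : nat) :
  bip_cover_size d n -> n <= iter d (fun m => d * m.+1) 0.
Proof.
move=> [V [e [M [[X [_ _ eX]] Mmin Md <-]]]].
pose star v := [set A in M | v \in A]%SET.
pose F := [set star x | x in X]%SET; pose H := [set star y | y in ~: X]%SET.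
have Fd : {in F, forall E : {set {set V}}, #|E| <= d}.
  by move=> _ /imsetP[x _ ->]; exact: Md.
have FH : {in F & H, forall E C : {set {set V}}, E :&: C != finset.set0}.
  move=> _ _ /imsetP[x xX ->] /imsetP[y yX ->]; rewrite inE in yX.
  have /Mmin.1[A [AM xA yA]] : e x y by rewrite eX xX (negbTE yX).
  by apply/set0Pn; exists A; rewrite !inE AM xA yA.
apply: leq_trans (critical_bound Fd FH d finset.set0).
apply/subset_leq_card/fintype.subsetP => A AM; rewrite !inE /=.
have [x [y [xX yX xA yA Axy]]] := private_edge eX Mmin AM.
apply/exists_inP; exists (star y); first by apply: imset_f; rewrite inE.
rewrite finset.sub0set finset.setD0 Md /=.
apply/exists_inP; exists (star x); first exact: imset_f.
apply/eqP/setP => B; rewrite !inE; apply/idP/eqP => [|->]; last by rewrite AM xA yA.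
by move=> /andP[/andP[BM xB] /andP[_ yB]]; exact: Axy.
Qed.

(** A single edge, covered by the set of its two ends, shows that the maximum $b(d)$ is taken over a
    nonempty set. *)
Lemma bip_cover_size1 (d : nat) : 1 <= d -> bip_cover_size d 1.
Proof.
move=> d1; exists bool, (fun x y => x (+) y), [set [set: bool]]%SET.
split; last by rewrite cards1.
- exists [set true]%SET; split.
  + by apply/set0Pn; exists true; rewrite inE.
  + by apply/set0Pn; exists false; rewrite !inE.
  + by move=> x y; rewrite !inE !eqb_id.
- split; first by move=> x y _; exists [set: bool]%SET; rewrite !inE.
  by move=> M'; rewrite finset.properEneq finset.subset1 => /andP[/negPf->] /= /eqP->
    /(_ true false erefl)[A]; rewrite inE => -[].
- move=> x; apply: leq_trans d1; rewrite -(cards1 ([set: bool]%SET)).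
  by apply/subset_leq_card/fintype.subsetP => A; rewrite inE => /andP[].
Qed.

Lemma is_b_exists (d : nat) : 1 <= d -> exists b, is_b d b.
Proof.
move=> d1; pose P n := `[< bip_cover_size d n >].
have exP : exists n, P n by exists 1; exact/asboolP/bip_cover_size1.
have ubP n : P n -> n <= iter d (fun m => d * m.+1) 0.
  by move=> /asboolP/bip_cover_size_bounded.
case: (ex_maxnP exP ubP) => b /asboolP Pb bmax.
by exists b; split=> // n Pn; apply: bmax; exact/asboolP.
Qed.

(** * Passing between families of covers and edge covers *)

(* An element [a] of the union becomes the set of all members of [F] and [H]
   containing [a]. The vertices are indexed by the union, [inl i] and [inr i]
   standing for a pair [E i], [C i] that meets only in [x i]. *)
Lemma bip_cover_size_bigcup {T : Type} {d n : nat} {F H : set (set T)} :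
    0 < n -> (forall E, F E -> E #<= `I_d) ->
    (forall C, H C -> is_minimal_cover F C /\ C #<= `I_d) ->
  \bigcup_(C in H) C #= `I_n -> bip_cover_size d n.
Proof.
move=> n0 Fd Hd /card_eq_enum[x xI xH].
have /choice[EC ECP] i : exists EC : set T * set T,
    [/\ F EC.1, H EC.2 & EC.2 `&` EC.1 = [set x i]].
  have [C HC Cx] : (\bigcup_(C in H) C) (x i) by rewrite -xH; exists i.
  by have [E FE CE] := minimal_cover_critical (Hd C HC).1 Cx; exists (E, C).
pose V := ('I_n + 'I_n)%type.
pose U (v : V) : set T := match v with inl i => (EC i).1 | inr i => (EC i).2 end.
pose A j := [set v : V | `[< U v (x j) >]]%SET.
(* Among the sets [A j], only [A i] can contain the edge from [inl i] to [inr i]; this gives both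
   the injectivity of [A] and minimality. *)
have AP i j : inl i \in A j -> inr i \in A j -> j = i.
  rewrite !inE => EiA CiA; apply: xI.
  by have [_ _ /seteqP[/(_ (x j)) /= ECi _]] := ECP i; apply: ECi.
have Alr i : inl i \in A i /\ inr i \in A i.
  have [_ _ /seteqP[_ /(_ (x i) erefl) [Ci Ei]]] := ECP i.
  by rewrite !inE.
have AI : injective A.
  by move=> i j Aij; have [] := Alr i; rewrite Aij => /AP/[apply] ->.
pose X : {set V} := [set v | if v is inl _ then true else false]%SET.
exists V, (fun v w => (v \in X) (+) (w \in X)), [set A j | j in 'I_n]%SET.
split; last by rewrite card_imset // card_ord.
- exists X; split=> //; apply/set0Pn.
  + by exists (inl (Ordinal n0)); rewrite inE.
  + by exists (inr (Ordinal n0)); rewrite !inE.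
- split.
    suff half i j : exists k, inl i \in A k /\ inr j \in A k.
      move=> [i|i] [j|j]; rewrite !inE // => _.
      - by have [k []] := half i j; exists (A k); rewrite imset_f.
      - by have [k []] := half j i; exists (A k); rewrite imset_f.
    have [FE _ _] := ECP i; have [_ HC _] := ECP j.
    have [a [Ca Ea]] := (Hd _ HC).1.1 _ FE.
    have [k _ xk] : range x a by rewrite xH; exists (EC j).2.
    by exists k; rewrite !inE /U xk.
  move=> M' /properP[M'A [_ /imsetP[i _ ->] AiM']] M'cov.
  have /M'cov[B [BM' lB rB]] : (inl i \in X) (+) (inr i \in X) by rewrite !inE.
  have /imsetP[j _ BA] := fintype.subsetP M'A _ BM'.
  by move: lB rB; rewrite BA => /AP/[apply] ji; rewrite BA ji (negbTE AiM') in BM'.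
- move=> v; have Uv : U v #<= `I_d.
    by case: v => i /=; have [FE HC _] := ECP i; [exact: Fd|exact: (Hd _ HC).2].
  (* The sets [A j] through [v] correspond to the points [x j] of [U v]. *)
  apply: leq_trans (card_preimage_finset xI Uv).
  rewrite -(card_imset _ AI); apply/subset_leq_card/fintype.subsetP => B.
  rewrite inE => /andP[/imsetP[j _ ->]]; rewrite inE => vj.
  by rewrite imset_f // inE.
Qed.

Lemma bigcup_card_le {T : Type} {d b : nat} {F H : set (set T)} :
  is_b d b -> admissible d F H -> \bigcup_(C in H) C #<= `I_b.
Proof.
move=> [_ bmax] [_ Fd Hd]; apply: contrapT => /negP nle.
have /card_subP[S Sb SH] : `I_b.+1 #<= \bigcup_(C in H) C.
  have [[n Hn]|/infiniteP] := pselect (finite_set (\bigcup_(C in H) C)).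
    by move: nle; rewrite (card_le_eql Hn) (card_le_eqr Hn) !card_le_II -ltnNge.
  exact: card_le_trans (card_leT _).
have [x xI xS] := card_eq_enum Sb.
(* One cover through each of the [b.+1] points of [S] suffices: [F] is kept, so these covers stay
   minimal, and their union is finite because each has at most [d] elements. *)
have /choice[C CP] i : exists C, H C /\ C (x i).
  by have [C HC Cx] := SH (x i) (eq_ind _ (fun S => S (x i)) (imageT x i) _ xS); exists C.
have CH D : range C D -> H D by move=> [i _ <-]; exact: (CP i).1.
have [n Cn] : finite_set (\bigcup_(D in range C) D).
  apply: bigcup_finite; first exact/finite_image/finite_finset.
  by move=> D /CH HD; apply: card_le_finite (Hd D HD).2 (finite_II d).
have bn : b.+1 <= n.
  rewrite -card_le_II -(card_le_eql Sb) -(card_le_eqr Cn).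
  apply: subset_card_le; rewrite -xS => _ [i _ <-].
  by exists (C i); [exists i | exact: (CP i).2].
have := bmax n; rewrite leqNgt bn => /(_ _)/negP; apply => //.
apply: (bip_cover_size_bigcup _ Fd _ Cn); first exact: leq_trans bn.
by move=> D /CH; exact: Hd.
Qed.

(* Dually, a vertex [v] of the graph becomes the set of members of [M]
   containing [v]; one part yields [F], the other yields covers of [F]. *)
Lemma bip_cover_size_le_bigcup {d n : nat} : bip_cover_size d n ->
  exists (T : Type) (F H : set (set T)),
    admissible d F H /\ `I_n #<= \bigcup_(C in H) C.
Proof.
move=> [V [e [M [[X [_ _ eX]] Mmin Md <-]]]].
pose star v := [set A in M | v \in A]%SET.
pose F := [set [set` star x] | x in [set` X]].
pose H := [set C | is_minimal_cover F C /\ C #<= `I_d].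
have stard v : [set` star v] #<= `I_d.
  by rewrite (card_le_eql (card_eq_finset _)) card_le_II; exact: Md.
exists {set V}, F, H; split.
  by split=> [|_ [x _ <-]|//]; [exact/finite_image/finite_finset|exact: stard].
rewrite -(card_le_eql (card_eq_finset M)); apply: subset_card_le => A /= AM.
have [x [y [xX yX xA yA Axy]]] := private_edge eX Mmin AM.
(* The star of [y] is a cover, but perhaps not a minimal one. Shrinking it to a minimal cover keeps
   [A], the only element it shares with the star of [x]. *)
have /sub_minimal_cover[C Cy Cmin] : is_cover F [set` star y].
  move=> _ [z zX <-]; have /Mmin.1[B [BM zB yB]] : e z y by rewrite eX zX (negbTE yX).
  by exists B; rewrite /= !inE BM zB yB.
exists [set` C].
  split=> //; apply: card_le_trans (stard y).
  by apply: subset_card_le => B /= /(fintype.subsetP Cy).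
have [B [/= BC]] : [set` C] `&` [set` star x] !=set0.
  by apply: Cmin.1; exists x.
rewrite inE => /andP[BM xB].
have := fintype.subsetP Cy _ BC; rewrite inE => /andP[_ yB].
by rewrite -(Axy B BM xB yB).
Qed.

Theorem theorem1p4 (d : nat) (hd : 1 <= d) :
  exists b : nat,
    [/\ is_b d b,
        forall (T : Type) (F H : set (set T)),
          admissible d F H -> \bigcup_(C in H) C #<= `I_b
      & exists (T : Type) (F H : set (set T)),
          admissible d F H /\ \bigcup_(C in H) C #= `I_b].
Proof.
have [b bP] := is_b_exists d hd; exists b; split=> // [T F H|].
  exact: bigcup_card_le.
have [T [F [H [FH bH]]]] := bip_cover_size_le_bigcup bP.1.
by exists T, F, H; rewrite card_eq_le bH (bigcup_card_le bP FH).
Qed.
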